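(* Let $k\geq 12$ be a positive integer. Let $A$ be a finite set of $k$ integers such that $\min(A)=0$, $\gcd(A)=1$, and $|3^{\wedge}A| = 3k-6$. Then $A=[0,k+1]\setminus\{x,y\}$, where $\{x,y\}$ is one of the sets $\{1,2\}$, $\{k-1,k\}$, $\{1,k\}$, $\{2,k+1\}$, $\{3,k+1\}$, $\{k-2,k+1\}$, $\{k-3,k+1\}$.
   Context: For a finite set $A$ of integers and a positive integer $h\le |A|$, the restricted $h$-fold sumset $h^{\wedge}A$ is the set of all sums of $h$ distinct elements of $A$. For integers $\alpha\le\beta$, $[\alpha,\beta]=\{x\in\mathbb{Z}:\alpha\le x\le\beta\}$. $\gcd(A)$ denotes the greatest common divisor of the elements of $A$. *)

(* Defs.v *)
From mathcomp Require Import all_boot all_order all_algebra finmap.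
From mathcomp Require Import zify.
Set Implicit Arguments.
Unset Strict Implicit.
Unset Printing Implicit Defensive.

Import Order.TTheory GRing.Theory Num.Theory.
Local Open Scope fset_scope.
Local Open Scope ring_scope.

Definition restricted_sumset (h : nat) (A : {fset int}) : {fset int} :=
  [fset \sum_(x <- B) x | B : {fset int} in [fset B in fpowerset A | #|` B| == h]].

Notation "h ^^ A" := (restricted_sumset h A)
  (at level 30, right associativity) : fset_scope.

Definition fset_gcd (A : {fset int}) : int := \big[gcdz/0]_(x <- A) x.

Definition is_fset_min (A : {fset int}) (m : int) : Prop :=
  m \in A /\ {in A, forall a, m <= a}.

Definition int_interval (a b : int) : {fset int} :=
  if a <= b then [fset a + i%:Z | i in iota 0 `|b - a|.+1] else fset0.

Lemma in_restricted_sumset (h : nat) (A : {fset int}) (s : int) :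
  reflect (exists B : {fset int},
             [/\ B `<=` A, #|` B| = h & s = \sum_(x <- B) x])
          (s \in h ^^ A).
Proof.
apply: (iffP (imfsetP _ _ _ _)) => /= [[B]|[B [sBA cB ->]]].
  by rewrite !inE fpowersetE => /andP[sBA /eqP cB] ->; exists B.
by exists B; rewrite // !inE fpowersetE sBA cB eqxx.
Qed.

Lemma in_int_interval (a b x : int) :
  (x \in int_interval a b) = (a <= x <= b).
Proof.
rewrite /int_interval; case: ifPn => ab; last by rewrite inE; lia.
apply/(imfsetP _ _ _ _)/idP => /= [[i]|ax].
  by rewrite inE mem_iota => hi ->; lia.
by exists `|x - a|%N; rewrite ?inE ?mem_iota; lia.
Qed.

(* Main.v *)
Require Import Defs.
From mathcomp Require Import all_boot all_order all_algebra finmap.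
From mathcomp Require Import zify.
Import Order.TTheory GRing.Theory Num.Theory.
Local Open Scope fset_scope.
Local Open Scope ring_scope.

(* Write [A] as an increasing sequence of k elements and let [cnt] count the
   sums of three distinct entries. The first m + 3 entries and the entries
   from position m on share only one sum, so every window of w consecutive
   entries has at most 3w - 6 sums, as [A] itself does, and three windows of
   five entries inside a window of nine cannot all fail to be arithmetic
   progressions, which are the only 5-sets with 7 sums. A progression of five
   terms can be extended by one entry within the bound only if the new entry
   lies on the same lattice, in a finite set of positions; so the windows of
   nine entries are copies of finitely many shapes, found by computation. All of
   them have constant gaps away from the ends, hence so does [A], and the common
   gap divides the gcd. The excess of [cnt] over 3k - 8 is then the sum of the
   excesses caused by the two ends of [A]. *)

(** * Sums of [h] entries of a sequence, and their number for [h = 3] *)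

(** The recursion branches on whether the head is a summand. It works on lists, with repetitions, so
    that the later finite searches can be evaluated. *)
Fixpoint sums (h : nat) (s : seq int) : seq int :=
  match h, s with
  | 0%N, _ => [:: 0]
  | h'.+1, x :: s' => [seq x + y | y <- sums h' s'] ++ sums h s'
  | _, [::] => [::]
  end.

Definition cnt (s : seq int) : nat := size (undup (sums 3 s)).
Arguments cnt : simpl never.

Lemma mem_sums (h : nat) (s : seq int) (y : int) :
  y \in sums h s <->
  exists u, [/\ subseq u s, size u = h & y = \sum_(x <- u) x].
Proof.
elim: s h y => [|x s IH] [|h] y.
- rewrite inE; split=> [/eqP->|[[|? ?] [] //= _ _ ->]]; last by rewrite big_nil.
  by exists [::]; rewrite big_nil.
- by split=> // -[[|? ?] [] //].
- rewrite inE; split=> [/eqP->|[[|? ?] [] //= _ _ ->]]; last by rewrite big_nil.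
  by exists [::]; rewrite big_nil.
rewrite /= mem_cat; split=> [/orP[/mapP[z /IH[u [su zu ->]] ->]|/IH[u [su zu ->]]]|].
- by exists (x :: u); rewrite /= eqxx zu big_cons.
- by exists u; split=> //; apply: subseq_trans su (subseq_cons s x).
case=> -[|z u] [] //= su [zu] yE; apply/orP.
move: su; case: eqP => [zx su|_ su].
  left; apply/mapP; exists (\sum_(i <- u) i); last by rewrite yE big_cons zx.
  by apply/IH; exists u.
by right; apply/IH; exists (z :: u); rewrite /= zu.
Qed.

(** Filtering [s] by membership in [u] gives a subsequence that is a permutation of [u], so the
    order of the summands can be forgotten. *)
Lemma mem_sums_uniq (h : nat) (s : seq int) (y : int) : uniq s ->
  y \in sums h s <->
  exists u, [/\ uniq u, {subset u <= s}, size u = h & y = \sum_(x <- u) x].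
Proof.
move=> us; rewrite mem_sums; split=> -[u [su zu yu]].
  by exists u; split; rewrite ?(subseq_uniq su us) //; apply: mem_subseq.
move=> yE; have pu : perm_eq u [seq x <- s | x \in u].
  apply: uniq_perm => // [|x]; first exact: filter_uniq.
  by rewrite mem_filter; case: (boolP (x \in u)) => //= /zu->.
exists [seq x <- s | x \in u]; split; first exact: filter_subseq.
  by rewrite -(perm_size pu).
by rewrite yE; apply: perm_big.
Qed.

Lemma sub_sums (h : nat) (s s' : seq int) : uniq s -> uniq s' ->
  {subset s <= s'} -> {subset sums h s <= sums h s'}.
Proof.
move=> us us' ss' y /(mem_sums_uniq _ _ _ us)[u [uu su zu yE]].
by apply/(mem_sums_uniq _ _ _ us'); exists u; split=> // x /su/ss'.
Qed.

Lemma sums_map (h : nat) (f : int -> int) (t c : int) (s : seq int) :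
  (forall x, f x = t + c * x) ->
  sums h [seq f x | x <- s] = [seq h%:R * t + c * y | y <- sums h s].
Proof.
move=> fE; elim: s h => [|x s IH] [|h] //=; try by rewrite mul0r mulr0.
rewrite map_cat !IH -!map_comp; congr (_ ++ _); apply: eq_map => y /=.
rewrite fE -natr1; lia.
Qed.

Lemma eq_cnt (s s' : seq int) : uniq s -> uniq s' -> s =i s' -> cnt s = cnt s'.
Proof.
move=> us us' ss'; apply/perm_size/uniq_perm; rewrite ?undup_uniq // => x.
by rewrite !mem_undup; apply/idP/idP; apply: sub_sums => // y; rewrite ss'.
Qed.

Lemma cnt_affine (t c : int) (s : seq int) : c != 0 ->
  cnt [seq t + c * x | x <- s] = cnt s.
Proof.
move=> c0; rewrite /cnt (sums_map _ _ t c) // undup_map_inj ?size_map //.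
by move=> x y /addrI/(mulfI c0).
Qed.

Lemma card_sums3 (s : seq int) : uniq s -> #|` 3 ^^ [fset x in s]| = cnt s.
Proof.
move=> us; rewrite /cnt -(card_fseq (sums 3 s)); congr #|` _|; apply/fsetP => y.
have -> : (y \in [fset x in sums 3 s]) = (y \in sums 3 s) by rewrite inE.
apply/in_restricted_sumset/idP.
  case=> B [/fsubsetP BA cB yE]; apply/(mem_sums_uniq _ _ _ us).
  exists B; split=> // [|x /BA]; first exact: fset_uniq.
  by rewrite inE.
case/(mem_sums_uniq _ _ _ us) => u [uu su zu yE]; exists [fset x in u]; split.
- by apply/fsubsetP => x; rewrite !inE => /su.
- by rewrite card_fseq undup_id.
rewrite yE; apply/perm_big/uniq_perm => // [|x]; first exact: fset_uniq.
by rewrite inE.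
Qed.

Lemma sum_size3 (u : seq int) (y : int) : size u = 3 -> uniq u ->
  y = \sum_(x <- u) x ->
  exists i j l, [/\ u = [:: i; j; l], i != j, i != l, j != l & y = i + j + l].
Proof.
case: u => [|i [|j [|l []]]] //= _; rewrite !inE negb_or andbT => /andP[/andP[ij il] jl].
by rewrite !big_cons big_nil addr0 addrA => yE; exists i, j, l.
Qed.

(** * Bounds on the number of sums of an increasing sequence *)

(** Of three distinct summands at most one is [a] and at most one is [b]; the others are at least
    [c]. *)
Lemma sums3_ge (q : seq int) (a b c y : int) : uniq q -> a < b < c ->
  (forall x, x \in q -> [\/ x = a, x = b | c <= x]) ->
  y \in sums 3 q -> a + b + c <= y.
Proof.
move=> uq abc qP /(mem_sums_uniq _ _ _ uq)[u [uu su zu yE]].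
have [i [j [l [uE ij il jl ->]]]] := sum_size3 u y zu uu yE.
have := qP i; have := qP j; have := qP l.
rewrite !su ?uE ?inE ?eqxx ?orbT // => Pl Pj Pi.
by case: (Pl erefl); case: (Pj erefl); case: (Pi erefl); lia.
Qed.

Lemma sums3_le (p : seq int) (a b c y : int) : uniq p -> a < b < c ->
  (forall x, x \in p -> [\/ x = c, x = b | x <= a]) ->
  y \in sums 3 p -> y <= a + b + c.
Proof.
move=> up abc pP /(mem_sums_uniq _ _ _ up)[u [uu su zu yE]].
have [i [j [l [uE ij il jl ->]]]] := sum_size3 u y zu uu yE.
have := pP i; have := pP j; have := pP l.
rewrite !su ?uE ?inE ?eqxx ?orbT // => Pl Pj Pi.
by case: (Pl erefl); case: (Pj erefl); case: (Pi erefl); lia.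
Qed.

Lemma lt_sorted_nth (s : seq int) (i j : nat) : sorted <%R s ->
  (i < j)%N -> (j < size s)%N -> nth 0 s i < nth 0 s j.
Proof.
by move=> ss ij js; rewrite lt_sorted_ltn_nth ?inE //; apply: ltn_trans js.
Qed.

Lemma le_sorted_nth (s : seq int) (i j : nat) : sorted <%R s ->
  (i <= j)%N -> (j < size s)%N -> nth 0 s i <= nth 0 s j.
Proof.
move=> ss; rewrite leq_eqVlt => /orP[/eqP->//|ij] js.
exact/ltW/lt_sorted_nth.
Qed.

Lemma sorted_sums3_ge (s : seq int) (y : int) : sorted <%R s ->
  (3 <= size s)%N -> y \in sums 3 s -> nth 0 s 0 + nth 0 s 1 + nth 0 s 2 <= y.
Proof.
move=> ss s3; apply: sums3_ge => [||x /(nthP 0)[i im <-]].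
- exact: lt_sorted_uniq.
- by rewrite !lt_sorted_nth; lia.
case: i im => [|[|[|i]]] im; [exact: Or31 | exact: Or32 | exact: Or33 |].
exact/Or33/le_sorted_nth.
Qed.

Lemma sorted_sums3_le (s : seq int) (m : nat) (y : int) : sorted <%R s ->
  size s = (m + 3)%N -> y \in sums 3 s ->
  y <= nth 0 s m + nth 0 s m.+1 + nth 0 s m.+2.
Proof.
move=> ss s3; apply: sums3_le => [||x /(nthP 0)[i im <-]].
- exact: lt_sorted_uniq.
- by rewrite !lt_sorted_nth; lia.
have [->|[->|im']] : i = m.+2 \/ i = m.+1 \/ (i <= m)%N.
- by move: im; rewrite s3; lia.
- exact: Or31.
- exact: Or32.
by apply/Or33/le_sorted_nth; rewrite // s3; lia.
Qed.

(* The sums from the first [m + 3] entries and those from position [m] on lie on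
   either side of the one common sum. *)
Lemma cnt_take_drop (s : seq int) (m : nat) : sorted <%R s ->
  (m + 3 <= size s)%N ->
  (cnt (take (m + 3) s) + cnt (drop m s) <= (cnt s).+1)%N.
Proof.
move=> ss ms; have us := lt_sorted_uniq ss.
have [st sd] := (take_sorted (m + 3) ss, drop_sorted m ss).
set p := take _ _ in st *; set q := drop _ _ in sd *.
set t := nth 0 s m + nth 0 s m.+1 + nth 0 s m.+2.
have pU y : y \in sums 3 p -> y <= t.
  have pE j : (j < m + 3)%N -> nth 0 s j = nth 0 p j by move=> jm; rewrite nth_take.
  by rewrite /t !pE; try lia; apply: sorted_sums3_le => //; apply: size_takel.
have qL y : y \in sums 3 q -> t <= y.
  have -> : t = nth 0 q 0 + nth 0 q 1 + nth 0 q 2.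
    by rewrite /q !nth_drop addn0 addn1 addn2.
  by apply: sorted_sums3_ge => //; rewrite size_drop; lia.
set q' := [seq y <- undup (sums 3 q) | y != t].
have cq : (cnt q <= (size q').+1)%N.
  rewrite /cnt size_filter -(count_predC (pred1 t)) -[X in (_ <= X)%N]add1n leq_add2r.
  by rewrite count_uniq_mem ?undup_uniq // leq_b1.
apply: leq_trans (leq_add (leqnn _) cq) _; rewrite addnS ltnS -size_cat.
apply: uniq_leq_size => [|y].
  rewrite cat_uniq undup_uniq filter_uniq ?undup_uniq // andbT.
  apply/hasPn => y; rewrite mem_filter !mem_undup => /andP[ny /qL ly].
  by apply/negP => /pU; lia.
rewrite mem_cat mem_filter !mem_undup => /orP[|/andP[_]]; apply: sub_sums => //.
- exact: lt_sorted_uniq.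
- exact: mem_take.
- exact: lt_sorted_uniq.
- exact: mem_drop.
Qed.

(** All sums lie between the sum of the three smallest entries and that of the three largest, and
    that interval has only so many integers. *)
Lemma cnt_le (s : seq int) (m : nat) : sorted <%R s -> size s = (m + 3)%N ->
  (cnt s)%:Z <= nth 0 s m + nth 0 s m.+1 + nth 0 s m.+2
                - (nth 0 s 0 + nth 0 s 1 + nth 0 s 2) + 1.
Proof.
move=> ss sz; set hi : int := _ + nth 0 s m.+2; set lo : int := _ + nth 0 s 2.
have L (y : int) : y \in sums 3 s -> lo <= y by apply: sorted_sums3_ge; lia.
have U (y : int) : y \in sums 3 s -> y <= hi by apply: sorted_sums3_le.
have : (cnt s <= size [seq (lo + i%:Z)%R | i <- iota 0 `|(hi - lo + 1)%R|])%N.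
  apply: uniq_leq_size; first exact: undup_uniq.
  move=> y; rewrite mem_undup => ys; have := L y ys; have := U y ys => h1 h2.
  by apply/mapP; exists `|y - lo|%N; rewrite ?mem_iota; lia.
have lohi : lo <= hi.
  by apply: lerD; [apply: lerD|]; apply: le_sorted_nth; rewrite ?sz; lia.
by rewrite size_map size_iota; lia.
Qed.

(** Induction on the length: the first four entries have at least 4 sums, of which one is shared
    with the tail, so each new entry brings at least 3. *)
Lemma cnt_ge (s : seq int) : sorted <%R s -> (3 <= size s)%N ->
  (3 * size s <= cnt s + 8)%N.
Proof.
elim: s => // x s IH ss sz.
have [s2|s3] : size s = 2%N \/ (3 <= size s)%N by move: sz => /=; lia.
  by case: s s2 {IH ss sz} => [|? [|? []]].
have := cnt_take_drop (x :: s) 1 ss s3; rewrite [drop _ _]drop1 [behead _]/=.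
have := IH (path_sorted ss) s3; rewrite [size (x :: s)]/=.
suff : (4 <= cnt (take 4 (x :: s)))%N by rewrite -[(1 + 3)%N]/4%N; lia.
case: s ss s3 {IH sz} => [|a [|b [|c s]]] //= /and4P[xa ab bc _] _.
apply: (@uniq_leq_size _ [:: x + (a + b); x + (a + c); x + (b + c); a + (b + c)]).
  by rewrite /= !inE; lia.
by move=> y; rewrite !inE mem_undup /= take0 /= !inE; lia.
Qed.

(** The first [i + 3] entries have at least [3 * i + 1] sums and share one with the rest, so
    dropping [i] entries loses at least [3 * i] sums. The same holds at the other end. *)
Lemma cnt_window (s : seq int) (i w : nat) : sorted <%R s ->
  (3 <= w)%N -> (i + w <= size s)%N -> (cnt s + 6 <= 3 * size s)%N ->
  (cnt (take w (drop i s)) + 6 <= 3 * w)%N.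
Proof.
move=> ss w3 iw cs.
have H1 : (cnt (drop i s) + 6 <= 3 * size (drop i s))%N.
  have := cnt_take_drop s i ss; have := cnt_ge (take (i + 3) s) (take_sorted _ ss).
  by rewrite size_drop size_takel; lia.
have ss' := drop_sorted i ss; move: H1 ss'.
have : (w <= size (drop i s))%N by rewrite size_drop; lia.
move: (drop i s) => v wv cv sv.
have := cnt_take_drop v (w - 3) sv; have := cnt_ge (drop (w - 3) v) (drop_sorted _ sv).
by rewrite subnK // size_drop; lia.
Qed.

(** * Affine copies of a shape, and their extension by one entry *)

Definition is_copy (Ps : seq (seq int)) (u : seq int) : Prop :=
  exists P t c, [/\ P \in Ps, 0 < c & u = [seq t + c * x | x <- P]].

Definition ap5 : seq int := [:: 0; 1; 2; 3; 4].

(** The sums in [T] form a strictly increasing chain of length 7, so under the bound there are no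
    others. *)
Lemma is_copy_ap5 (u : seq int) : sorted <%R u -> size u = 5 ->
  (cnt u <= 7)%N -> is_copy [:: ap5] u.
Proof.
case: u => [|a [|b [|c [|d [|e []]]]]] // su _ cu.
have /and5P[ab bc cd de _] := su.
pose T := [:: a + b + c; a + b + d; a + c + d; b + c + d; b + c + e; b + d + e;
              c + d + e].
have uT : uniq T by apply: lt_sorted_uniq; rewrite /=; lia.
have sT : {subset T <= undup (sums 3 [:: a; b; c; d; e])}.
  by move=> x; rewrite !inE mem_undup /= !inE; lia.
have [_ eT] := uniq_min_size uT sT cu.
have inT x : x \in sums 3 [:: a; b; c; d; e] -> x \in T by rewrite eT mem_undup.
(* Since [a + c + e] lies strictly between [a + c + d] and [b + c + e], it is [b + c + d]. Then
   [a + b + e] must be [a + c + d] and [a + d + e] must be [b + c + e], so all gaps are equal. *)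
have := inT (a + c + e); have := inT (a + b + e); have := inT (a + d + e).
rewrite /= !inE => h1 h2 h3; exists ap5, a, (b - a); split; rewrite ?inE //; first lia.
by rewrite /=; do 5?[congr (_ :: _)]; lia.
Qed.

(** If a sum using the new entry [j] equals a sum of three entries of [P], then [j] is one of these
    differences, so the candidates are finitely many. *)
Definition extensions (P : seq int) : seq int :=
  [seq j <- undup [seq x - y | x <- undup (sums 3 P), y <- undup (sums 2 P)] |
    (cnt (j :: P) + 6 <= 3 * (size P).+1)%N].

Definition extendable (P : seq int) : bool :=
  (3 * (size P).+1 < cnt P + size (undup (sums 2 P)) + 6)%N.

(* Otherwise the sums with [m] and those without it would be disjoint, hence too
   many. *)
Lemma extensionP (P : seq int) (t c m : int) : extendable P -> c != 0 ->
  (cnt (m :: [seq (t + c * x)%R | x <- P]) + 6 <= 3 * (size P).+1)%N ->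
  exists2 j, j \in extensions P & m = t + c * j.
Proof.
move=> eP c0 cm; set u := [seq t + c * x | x <- P] in cm.
have sE h : sums h u = [seq h%:R * t + c * y | y <- sums h P] by exact: sums_map.
have injc h : injective (fun y : int => h%:R * t + c * y).
  by move=> x y /addrI/(mulfI c0).
case: (boolP (has (mem (sums 3 u)) [seq m + y | y <- sums 2 u])) => [/hasP[z]|dis].
  rewrite !sE => /mapP[_ /mapP[y y2 ->] ->] /mapP[x x3 xyE].
  have mE : m = t + c * (x - y) by lia.
  exists (x - y) => //; rewrite mem_filter; apply/andP; split.
    by move: cm; rewrite mE /u -[_ :: _]/[seq t + c * i | i <- (x - y) :: P] cnt_affine.
  by rewrite mem_undup; apply/allpairsP; exists (x, y); rewrite !mem_undup.
move: eP; rewrite /extendable ltnNge => /negP; case; move: cm.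
rewrite {1}/cnt -[sums 3 (m :: u)]/([seq m + y | y <- sums 2 u] ++ sums 3 u).
rewrite undup_cat size_cat.
have -> : [seq x <- undup [seq m + y | y <- sums 2 u] | x \notin sums 3 u]
    = undup [seq m + y | y <- sums 2 u].
  apply/all_filterP/allP => z; rewrite mem_undup => zm.
  by apply: contraNN dis => zu; apply/hasP; exists z.
rewrite -/(cnt u) undup_map_inj ?size_map; last by move=> x y /addrI.
by rewrite sE undup_map_inj // size_map /u cnt_affine // [(_ + cnt P)%N]addnC.
Qed.

Definition stepr (Ps : seq (seq int)) : seq (seq int) :=
  [seq rcons P j | P <- Ps, j <- [seq j <- extensions P | all (fun x => x < j) P]].

Definition stepl (Ps : seq (seq int)) : seq (seq int) :=
  [seq j :: P | P <- Ps, j <- [seq j <- extensions P | all (fun x => j < x) P]].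

Lemma is_copy_rcons (Ps : seq (seq int)) (u : seq int) (m : int) :
  all extendable Ps -> is_copy Ps u -> sorted <%R (rcons u m) ->
  (cnt (rcons u m) + 6 <= 3 * (size u).+1)%N -> is_copy (stepr Ps) (rcons u m).
Proof.
move=> ePs [P [t [c [PPs c0 uE]]]] su cu.
have ur := lt_sorted_uniq su.
have um : uniq (m :: u) by move: ur; rewrite rcons_uniq.
move: cu; rewrite (eq_cnt _ (m :: u)) // => [|x]; last by rewrite mem_rcons.
rewrite uE size_map => /(extensionP _ _ _ _ (allP ePs _ PPs) (lt0r_neq0 c0))[j jP mE].
exists (rcons P j), t, c; split=> //; last by rewrite map_rcons mE.
apply/allpairsPdep; exists P, j; split=> //; rewrite mem_filter jP andbT.
apply/allP => x xP; rewrite -(ltr_pM2l c0) -(ltrD2l t) -mE.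
move: su; rewrite sorted_pairwise; last exact: lt_trans.
by rewrite pairwise_rcons uE => /andP[/allP su _]; apply: su; apply: map_f.
Qed.

Lemma is_copy_cons (Ps : seq (seq int)) (u : seq int) (m : int) :
  all extendable Ps -> is_copy Ps u -> sorted <%R (m :: u) ->
  (cnt (m :: u) + 6 <= 3 * (size u).+1)%N -> is_copy (stepl Ps) (m :: u).
Proof.
move=> ePs [P [t [c [PPs c0 uE]]]] su cu; move: cu.
rewrite uE size_map => /(extensionP _ _ _ _ (allP ePs _ PPs) (lt0r_neq0 c0))[j jP mE].
exists (j :: P), t, c; split=> //; last by rewrite /= mE.
apply/allpairsPdep; exists P, j; split=> //; rewrite mem_filter jP andbT.
apply/allP => x xP; rewrite -(ltr_pM2l c0) -(ltrD2l t) -mE.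
move: su; rewrite sorted_pairwise; last exact: lt_trans.
by rewrite /= uE => /andP[/allP su _]; apply: su; apply: map_f.
Qed.

(** * The shapes of windows of nine entries *)

(** The three lists correspond to a progression of five terms starting at position 0, 2 or 4 of the
    window; the missing entries are added on the right, on both sides, or on the left. *)
Definition shapes9 : seq (seq int) :=
  iter 4 stepr [:: ap5] ++ iter 2 stepr (iter 2 stepl [:: ap5]) ++
  iter 4 stepl [:: ap5].

(* The possible first three gaps, and last three gaps read backwards. *)
Definition edges : seq (int * int * int) :=
  [:: (1, 1, 1); (2, 1, 1); (3, 1, 1); (1, 2, 1); (1, 1, 2)].

Definition gap (s : seq int) (i : nat) : int := nth 0 s i.+1 - nth 0 s i.

(** The eight gaps are split as 3 + 2 + 3. The two central ones equal 1, which fixes the scale; the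
    outer triples are both read from the end inwards. *)
Definition tame (P : seq int) : bool :=
  [&& gap P 3 == 1, gap P 4 == 1, (gap P 0, gap P 1, gap P 2) \in edges,
      (gap P 7, gap P 6, gap P 5) \in edges & size P == 9].

Lemma shapes9_tame : all tame shapes9.
Proof. by vm_compute. Qed.

Lemma extendable_stepr (n : nat) : n \in iota 0 4 ->
  all extendable (iter n stepr [:: ap5]).
Proof. by apply/allP: n; vm_compute. Qed.

Lemma extendable_stepl (n : nat) : n \in iota 0 4 ->
  all extendable (iter n stepl [:: ap5]).
Proof. by apply/allP: n; vm_compute. Qed.

Lemma extendable_steplr (n : nat) : n \in iota 0 2 ->
  all extendable (iter n stepr (iter 2 stepl [:: ap5])).
Proof. by apply/allP: n; vm_compute. Qed.

Lemma is_copy_catl (Ps Qs : seq (seq int)) (u : seq int) :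
  is_copy Ps u -> is_copy (Ps ++ Qs) u.
Proof.
by case=> P [t [c [PPs c0 ->]]]; exists P, t, c; rewrite mem_cat PPs.
Qed.

Lemma is_copy_catr (Ps Qs : seq (seq int)) (u : seq int) :
  is_copy Qs u -> is_copy (Ps ++ Qs) u.
Proof.
by case=> P [t [c [PPs c0 ->]]]; exists P, t, c; rewrite mem_cat PPs orbT.
Qed.

(* Windows of five entries overlapping in three share a single sum, so three of
   them with at least 8 sums each would force 22 sums. *)
Lemma ap5_window (v : seq int) : sorted <%R v -> size v = 9 -> (cnt v <= 21)%N ->
  exists2 i, i \in [:: 0; 2; 4]%N & is_copy [:: ap5] (take 5 (drop i v)).
Proof.
move=> sv zv cv.
have ap5P i : (i <= 4)%N -> (cnt (take 5 (drop i v)) <= 7)%N ->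
    is_copy [:: ap5] (take 5 (drop i v)).
  move=> i4; apply: is_copy_ap5; first exact/take_sorted/drop_sorted.
  by rewrite size_takel // size_drop zv; lia.
have z2 : size (drop 2 v) = 7%N by rewrite size_drop zv.
have := cnt_take_drop v 2 sv; rewrite zv => /(_ isT).
have := cnt_take_drop (drop 2 v) 2 (drop_sorted _ sv); rewrite z2 => /(_ isT).
rewrite drop_drop => c1 c2.
case: (leqP (cnt (take 5 (drop 0 v))) 7) => [/ap5P|]; first by exists 0%N; auto.
case: (leqP (cnt (take 5 (drop 2 v))) 7) => [/ap5P|]; first by exists 2%N; auto.
case: (leqP (cnt (take 5 (drop 4 v))) 7) => [/ap5P|]; first by exists 4%N; auto.
rewrite drop0 [take 5 (drop 4 v)]take_oversize ?size_drop ?zv //.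
by move: c1 c2; rewrite -[(2 + 3)%N]/5%N -[(2 + 2)%N]/4%N; lia.
Qed.

Lemma is_copy_stepr (s : seq int) (i w : nat) (Ps : seq (seq int)) :
  sorted <%R s -> (cnt (take w.+1 (drop i s)) + 6 <= 3 * w.+1)%N ->
  (i + w < size s)%N -> all extendable Ps -> is_copy Ps (take w (drop i s)) ->
  is_copy (stepr Ps) (take w.+1 (drop i s)).
Proof.
move=> ss cs iw ePs cP.
have wd : (w < size (drop i s))%N by rewrite size_drop; lia.
have := take_sorted w.+1 (drop_sorted i ss); move: cs.
rewrite (take_nth 0) // => cs su; apply: is_copy_rcons => //.
by rewrite size_takel // ltnW.
Qed.

Lemma is_copy_stepl (s : seq int) (i w : nat) (Ps : seq (seq int)) :
  sorted <%R s -> (cnt (take w.+1 (drop i s)) + 6 <= 3 * w.+1)%N ->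
  (i + w < size s)%N -> all extendable Ps -> is_copy Ps (take w (drop i.+1 s)) ->
  is_copy (stepl Ps) (take w.+1 (drop i s)).
Proof.
move=> ss cs iw ePs cP.
have wd : (w <= size (drop i.+1 s))%N by rewrite size_drop; lia.
have := take_sorted w.+1 (drop_sorted i ss); move: cs.
rewrite (drop_nth 0); last exact: leq_ltn_trans (leq_addr w i) iw.
by rewrite take_cons => cs su; apply: is_copy_cons; rewrite // size_takel.
Qed.

Lemma is_copy_shapes9 (v : seq int) : sorted <%R v -> size v = 9 ->
  (forall i w, (3 <= w)%N -> (i + w <= 9)%N ->
     (cnt (take w (drop i v)) + 6 <= 3 * w)%N) ->
  is_copy shapes9 v.
Proof.
move=> sv zv cv.
have v9 : take 9 (drop 0 v) = v by rewrite drop0 take_oversize ?zv.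
have cv9 : (cnt v <= 21)%N by have := cv 0%N 9%N isT isT; rewrite v9; lia.
have rstep i w Ps : (2 <= w)%N -> (i + w < 9)%N -> all extendable Ps ->
    is_copy Ps (take w (drop i v)) -> is_copy (stepr Ps) (take w.+1 (drop i v)).
  by move=> w3 iw; apply: is_copy_stepr; rewrite ?zv //; apply: cv; lia.
have lstep i w Ps : (2 <= w)%N -> (i + w < 9)%N -> all extendable Ps ->
    is_copy Ps (take w (drop i.+1 v)) -> is_copy (stepl Ps) (take w.+1 (drop i v)).
  by move=> w3 iw; apply: is_copy_stepl; rewrite ?zv //; apply: cv; lia.
have [i] := ap5_window v sv zv cv9.
rewrite !inE /shapes9 -{2}v9 => /or3P[]/eqP-> apv.
- apply: is_copy_catl.
  do 4![rewrite iterS; apply: (rstep); [by []|by []|exact: extendable_stepr|]].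
  exact: apv.
- apply/is_copy_catr/is_copy_catl.
  do 2![rewrite iterS; apply: (rstep); [by []|by []|exact: extendable_steplr|]].
  do 2![rewrite iterS; apply: (lstep); [by []|by []|exact: extendable_stepl|]].
  exact: apv.
- apply/is_copy_catr/is_copy_catr.
  do 4![rewrite iterS; apply: (lstep); [by []|by []|exact: extendable_stepl|]].
  exact: apv.
Qed.

(** * From windows to the gaps of the whole sequence *)

Lemma window_gap (s : seq int) (i : nat) : sorted <%R s ->
  (i + 9 <= size s)%N -> (cnt s + 6 <= 3 * size s)%N ->
  exists P c, [/\ tame P, 0 < c &
    forall j, (j < 8)%N -> gap s (i + j) = c * gap P j].
Proof.
move=> ss is9 cs.
have zv : size (take 9 (drop i s)) = 9%N by rewrite size_takel // size_drop; lia.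
have [||P [t [c [/(allP shapes9_tame)tP c0 vE]]]] := is_copy_shapes9 _ _ zv.
- exact/take_sorted/drop_sorted.
- move=> i' w w3 iw; rewrite take_drop take_takel; last by lia.
  rewrite -take_drop drop_drop.
  by apply: cnt_window => //; lia.
have zP : size P = 9%N by rewrite -zv vE size_map.
exists P, c; split=> // j j8.
have nE l : (l < 9)%N -> nth 0 s (i + l) = t + c * nth 0 P l.
  by move=> l9; rewrite -nth_drop -(nth_take 0 l9) vE (nth_map 0) ?zP.
by rewrite /gap -addnS !nE; lia.
Qed.

Lemma gaps_shape (s : seq int) (n : nat) : sorted <%R s ->
  size s = (n + 12)%N -> (cnt s + 6 <= 3 * size s)%N ->
  exists g e1 e2 e3 f1 f2 f3,
    [/\ 0 < g, (e1, e2, e3) \in edges, (f1, f2, f3) \in edges,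
        [/\ gap s 0 = g * e1, gap s 1 = g * e2 & gap s 2 = g * e3] &
        [/\ forall j, (j <= n + 4)%N -> gap s (3 + j) = g,
            gap s (n + 10) = g * f1, gap s (n + 9) = g * f2 &
            gap s (n + 8) = g * f3]].
Proof.
move=> ss sz cs.
have W i : (i <= n + 3)%N -> exists P c, [/\ tame P, 0 < c &
    forall j, (j < 8)%N -> gap s (i + j) = c * gap P j].
  by move=> i3; apply: window_gap => //; lia.
(* Consecutive middle gaps are gaps 3 and 4 of one window, and both equal the scale of that
   window. *)
have mid j : (j <= n + 4)%N -> gap s (3 + j) = gap s 3.
  elim: j => [|j IH] jn; first by rewrite addn0.
  have [|P [c [/and5P[/eqP P3 /eqP P4 _ _ _] _ sP]]] := W j; first lia.
  rewrite -IH; last lia.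
  rewrite [(3 + j.+1)%N](_ : _ = j + 4)%N; last lia.
  by rewrite [(3 + j)%N]addnC !sP // P3 P4.
have [//|P [c [/and5P[/eqP P3 _ eP _ _] c0 sP]]] := W 0%N.
have [|Q [d [/and5P[/eqP Q3 _ _ fQ _] d0 sQ]]] := W (n + 3)%N; first lia.
have gE : gap s 3 = c by rewrite -[gap s 3]/(gap s (0 + 3)) sP // P3 mulr1.
(* Gap 3 of the last window is also a middle gap, so the first and last windows have the same
   scale. *)
have dc : d = c.
  rewrite -gE -(mid (n + 3)%N); last lia.
  by rewrite [(3 + (n + 3))%N]addnC sQ // Q3 mulr1.
have shift j : (n + 3 + j = n + (3 + j))%N by rewrite addnA.
exists c, (gap P 0), (gap P 1), (gap P 2), (gap Q 7), (gap Q 6), (gap Q 5).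
split=> //; first by split; [exact: sP 0%N isT | exact: sP 1%N isT | exact: sP 2%N isT].
split; first by move=> j jn; rewrite mid.
- by have := sQ 7%N isT; rewrite shift dc.
- by have := sQ 6%N isT; rewrite shift dc.
- by have := sQ 5%N isT; rewrite shift dc.
Qed.

Lemma dvdz_fset_gcd (A : {fset int}) (g : int) :
  {in A, forall a, (g %| a)%Z} -> (g %| fset_gcd A)%Z.
Proof.
move=> gA; rewrite /fset_gcd big_seq.
elim/big_ind: _ => [|x y gx gy|i iA]; [exact: dvdz0 | by rewrite dvdz_gcd gx | exact: gA].
Qed.

Lemma gap_nth (s : seq int) (i : nat) : nth 0 s i.+1 = nth 0 s i + gap s i.
Proof. by rewrite /gap; lia. Qed.

Lemma explicit_shape (A : {fset int}) (s : seq int) (n : nat) : sorted <%R s ->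
  size s = (n + 12)%N -> (cnt s + 6 <= 3 * size s)%N -> nth 0 s 0 = 0 ->
  A =i s -> fset_gcd A = 1 ->
  exists e1 e2 e3 f1 f2 f3,
    [/\ (e1, e2, e3) \in edges, (f1, f2, f3) \in edges &
      let e := e1 + e2 + e3 in
      [/\ nth 0 s 1 = e1, nth 0 s 2 = e1 + e2,
          forall j, (j <= n + 5)%N -> nth 0 s (3 + j) = e + j%:Z &
          [/\ nth 0 s (n + 9) = e + n%:Z + 5 + f3,
              nth 0 s (n + 10) = e + n%:Z + 5 + f3 + f2 &
              nth 0 s (n + 11) = e + n%:Z + 5 + f3 + f2 + f1]]].
Proof.
move=> ss sz cs s0 As gA.
have [g [e1 [e2 [e3 [f1 [f2 [f3 [g0 eE fE [d0 d1 d2] [mid d10 d9 d8]]]]]]]]] :=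
  gaps_shape s n ss sz cs.
have n1 : nth 0 s 1 = g * e1 by rewrite gap_nth s0 d0; lia.
have n2 : nth 0 s 2 = g * (e1 + e2) by rewrite gap_nth n1 d1; lia.
have n3 j : (j <= n + 5)%N -> nth 0 s (3 + j) = g * (e1 + e2 + e3 + j%:Z).
  elim: j => [|j IH] jn; first by rewrite addn0 gap_nth n2 d2; lia.
  by rewrite addnS gap_nth IH ?mid; lia.
have n9 : nth 0 s (n + 9) = g * (e1 + e2 + e3 + n%:Z + 5 + f3).
  have -> : (n + 9 = (n + 8).+1)%N by lia.
  rewrite gap_nth d8 [(n + 8)%N](_ : _ = 3 + (n + 5))%N; last lia.
  by rewrite n3; lia.
have n10 : nth 0 s (n + 10) = g * (e1 + e2 + e3 + n%:Z + 5 + f3 + f2).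
  have -> : (n + 10 = (n + 9).+1)%N by lia.
  by rewrite gap_nth d9 n9; lia.
have n11 : nth 0 s (n + 11) = g * (e1 + e2 + e3 + n%:Z + 5 + f3 + f2 + f1).
  have -> : (n + 11 = (n + 10).+1)%N by lia.
  by rewrite gap_nth d10 n10; lia.
(* The first entry is 0 and all gaps are multiples of [g], hence so are all entries. *)
have g1 : g = 1.
  have : (g %| fset_gcd A)%Z.
    apply: dvdz_fset_gcd => a; rewrite As => /(nthP 0)[i im <-].
    have [->|[->|[->|[il|[->|[->|->]]]]]] : i = 0%N \/ i = 1%N \/ i = 2 \/
        (3 <= i <= n + 8)%N \/ i = (n + 9)%N \/ i = (n + 10)%N \/ i = (n + 11)%N.
    - by move: im; rewrite sz; lia.
    - by rewrite s0 dvdz0.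
    - by rewrite n1 dvdz_mulr.
    - by rewrite n2 dvdz_mulr.
    - by rewrite -(subnKC (proj1 (andP il))) n3 ?dvdz_mulr //; lia.
    - by rewrite n9 dvdz_mulr.
    - by rewrite n10 dvdz_mulr.
    - by rewrite n11 dvdz_mulr.
  rewrite gA dvdz1; lia.
exists e1, e2, e3, f1, f2, f3; split=> //=; rewrite g1 !mul1r in n1 n2 n9 n10 n11.
by split=> // j jn; rewrite n3 // g1 mul1r.
Qed.

(** * The excess caused by each end, and the classification *)

(** Here 13 is [3 * 7 - 8], the least number of sums of seven entries, and [c] is the excess over
    it. The two lists are mirror images, one for each end of the sequence. *)
Lemma edge_cnt (e1 e2 e3 : int) : (e1, e2, e3) \in edges ->
  exists2 c : nat, cnt [:: 0; e1; e1 + e2; e1 + e2 + e3; e1 + e2 + e3 + 1;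
                         e1 + e2 + e3 + 2; e1 + e2 + e3 + 3] = (13 + c)%N /\
    cnt [:: 0; 1; 2; 3; 3 + e3; 3 + e3 + e2; 3 + e3 + e2 + e1] = (13 + c)%N &
  [\/ [/\ e1 = 1, e2 = 1, e3 = 1 & c = 0%N], [/\ e1 = 2, e2 = 1, e3 = 1 & c = 1%N],
   [/\ e1 = 3, e2 = 1, e3 = 1 & c = 2%N] |
   [/\ e1 = 1, e2 = 2, e3 = 1 & c = 2%N] \/ [/\ e1 = 1, e2 = 1, e3 = 2 & c = 2%N]].
Proof.
rewrite !inE => /or4P[/eqP[-> -> ->]|/eqP[-> -> ->]|/eqP[-> -> ->]|/orP[]/eqP[-> -> ->]].
- by exists 0%N; [split; vm_compute | constructor 1].
- by exists 1%N; [split; vm_compute | constructor 2].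
- by exists 2%N; [split; vm_compute | constructor 3].
- by exists 2%N; [split; vm_compute | constructor 4; left].
- by exists 2%N; [split; vm_compute | constructor 4; right].
Qed.

Theorem theorem1p11 (k : nat) (A : {fset int})
    (hk : (12 <= k)%N)
    (cardA : #|` A| = k)
    (minA : is_fset_min A 0)
    (gcdA : fset_gcd A = 1)
    (card3A : #|` 3 ^^ A| = (3 * k - 6)%N) :
  exists x y : int,
    A = int_interval 0 (k%:Z + 1) `\` [fset x; y] /\
    [fset x; y] \in
      [:: [fset 1; 2];
          [fset k%:Z - 1; k%:Z];
          [fset 1; k%:Z];
          [fset 2; k%:Z + 1];
          [fset 3; k%:Z + 1];
          [fset k%:Z - 2; k%:Z + 1];
          [fset k%:Z - 3; k%:Z + 1]].
Proof.
have [n kn] : exists n, k = (n + 12)%N by exists (k - 12)%N; rewrite subnK.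
pose s : seq int := sort <=%R A.
have ss : sorted <%R s by rewrite sort_lt_sorted fset_uniq.
have As : A =i s by move=> x; rewrite mem_sort.
have sz : size s = (n + 12)%N by rewrite size_sort cardA.
have cs : cnt s = (3 * k - 6)%N.
  rewrite -card3A -card_sums3 ?lt_sorted_uniq //; congr #|` 3 ^^ _|.
  by apply/fsetP => x; rewrite inE As.
have s0 : nth 0 s 0 = 0.
  have [A0 Age] := minA; apply/le_anti/andP; split; last first.
    by apply: Age; rewrite As mem_nth ?sz; lia.
  move: A0; rewrite As => /(nthP 0)[i im iE].
  by rewrite -[leRHS]iE; apply: le_sorted_nth.
have cs6 : (cnt s + 6 <= 3 * size s)%N by rewrite cs sz kn; lia.
have [e1 [e2 [e3 [f1 [f2 [f3 [eE fE [n1 n2 n3 [n9 n10 n11]]]]]]]]] :=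
  explicit_shape A s n ss sz cs6 s0 As gcdA.
(* Cutting at both ends, the first and last seven entries contribute [13 + c] and
   [13 + d] sums, and the k - 8 entries in between at least 3(k - 8) - 8. *)
have [c [c7 _] cE] := edge_cnt e1 e2 e3 eE.
have [d [_ d7] dE] := edge_cnt f1 f2 f3 fE.
have cost : (c + d <= 2)%N.
  have := cnt_take_drop s 4 ss; rewrite sz => H2; have {}H2 := H2 ltac:(lia).
  have := cnt_take_drop (drop 4 s) (n + 1) (drop_sorted 4 ss).
  rewrite size_drop sz drop_drop => H1; rewrite -[(4 + 3)%N]/7%N in H2.
  have {}H1 := H1 ltac:(lia).
  have := cnt_ge (take (n + 1 + 3) (drop 4 s)) (take_sorted _ (drop_sorted _ ss)).
  rewrite size_takel ?size_drop ?sz; last lia.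
  move=> H3; have {}H3 := H3 ltac:(lia).
  have E7 : take 7 s = [:: 0; e1; e1 + e2; e1 + e2 + e3; e1 + e2 + e3 + 1;
      e1 + e2 + e3 + 2; e1 + e2 + e3 + 3].
    apply: (@eq_from_nth _ 0) => [|i]; rewrite size_takel ?sz //; try lia.
    move=> i7; rewrite nth_take //; move: i i7.
    case=> [|[|[|[|[|[|[|i]]]]]]] //= _.
    - by rewrite (n3 0%N) // addr0.
    - exact: n3 1%N ltac:(lia).
    - exact: n3 2 ltac:(lia).
    - exact: n3 3 ltac:(lia).
  (* A translate, written with factor 1 so that [cnt_affine] applies. *)
  have D7 : drop (n + 1 + 4) s = [seq e1 + e2 + e3 + n%:Z + 2 + 1 * x |
      x <- [:: 0; 1; 2; 3; 3 + f3; 3 + f3 + f2; 3 + f3 + f2 + f1]].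
    apply: (@eq_from_nth _ 0) => [|i]; rewrite size_drop ?sz; first by rewrite /=; lia.
    move=> i7; have {}i7 : (i < 7)%N by lia.
    rewrite nth_drop; move: i i7.
    have mid j : (j <= 3)%N ->
        nth 0 s (n + 1 + 4 + j) = e1 + e2 + e3 + n%:Z + 2 + j%:Z.
      move=> j3; rewrite [(n + 1 + 4 + j)%N](_ : _ = 3 + (n + 2 + j))%N; last lia.
      by rewrite n3; lia.
    case=> [|[|[|[|[|[|[|i]]]]]]] //= _.
    - by rewrite mid //; lia.
    - by rewrite mid //; lia.
    - by rewrite mid //; lia.
    - by rewrite mid //; lia.
    - by rewrite -!addnA n9; lia.
    - by rewrite -!addnA n10; lia.
    - by rewrite -!addnA n11; lia.
  (* The two cuts share one sum each, so [26 + c + d + 3 * (k - 8) - 8] is at most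
     [3 * k - 6 + 2]. *)
  move: H1 H2; rewrite E7 D7 cnt_affine // c7 d7 cs kn; lia.
(* With [c + d] at most 1 the set is too narrow: the interval from the least to the largest possible
   sum has fewer than [3 * k - 6] integers. *)
have exact_cost : (2 <= c + d)%N.
  have := cnt_le s (n + 9) ss; rewrite sz -addnA => /(_ erefl).
  rewrite -!addnS n9 n10 n11 s0 n1 n2 cs kn.
  by case: cE => [[-> -> -> ->]|[-> -> -> ->]|[-> -> -> ->]|[[-> -> -> ->]|[-> -> -> ->]]];
     case: dE => [[-> -> -> ->]|[-> -> -> ->]|[-> -> -> ->]|[[-> -> -> ->]|[-> -> -> ->]]];
     lia.
have mem_s (z : int) : (z \in s) = [|| z == 0, z == e1, z == e1 + e2,
    e1 + e2 + e3 <= z <= e1 + e2 + e3 + n%:Z + 5,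
    z == e1 + e2 + e3 + n%:Z + 5 + f3, z == e1 + e2 + e3 + n%:Z + 5 + f3 + f2 |
    z == e1 + e2 + e3 + n%:Z + 5 + f3 + f2 + f1].
  apply/idP/idP => [/(nthP 0)[i im <-]|].
    have [->|[->|[->|[il|[->|[->|->]]]]]] : i = 0%N \/ i = 1%N \/ i = 2 \/
        (3 <= i <= n + 8)%N \/ i = (n + 9)%N \/ i = (n + 10)%N \/ i = (n + 11)%N.
    - by move: im; rewrite sz; lia.
    - by rewrite s0 eqxx.
    - by rewrite n1 eqxx ?orbT.
    - by rewrite n2 eqxx ?orbT.
    - by rewrite -(subnKC (proj1 (andP il))) n3; lia.
    - by rewrite n9 eqxx ?orbT.
    - by rewrite n10 eqxx ?orbT.
    - by rewrite n11 eqxx ?orbT.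
  have inS i : (i < n + 12)%N -> nth 0 s i \in s by move=> i12; rewrite mem_nth ?sz.
  case/or4P=> [/eqP->|/eqP->|/eqP->|/or4P[zE|/eqP->|/eqP->|/eqP->]].
  - by rewrite -{1}s0 inS; lia.
  - by rewrite -n1 inS; lia.
  - by rewrite -n2 inS; lia.
  - rewrite [z](_ : _ = e1 + e2 + e3 + `|(z - (e1 + e2 + e3))%R|%N%:Z); last lia.
    by rewrite -n3 ?inS; lia.
  - by rewrite -n9 inS; lia.
  - by rewrite -n10 inS; lia.
  - by rewrite -n11 inS; lia.
have AE (x y : int) :
    (forall z : int, z \in s <-> 0 <= z <= k%:Z + 1 /\ z != x /\ z != y) ->
    A = int_interval 0 (k%:Z + 1) `\` [fset x; y].
  move=> H; apply/fsetP => z; rewrite As in_fsetD in_int_interval in_fset2 negb_or.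
  apply/idP/idP => [/H[zk [-> ->]]|/andP[/andP[zx zy] zk]]; first by rewrite zk.
  exact/H.
have listed (x y : int) : [fset x; y] \in
      [:: [fset 1; 2]; [fset k%:Z - 1; k%:Z]; [fset 1; k%:Z]; [fset 2; k%:Z + 1];
          [fset 3; k%:Z + 1]; [fset k%:Z - 2; k%:Z + 1]; [fset k%:Z - 3; k%:Z + 1]] ->
    (forall z : int, z \in s <-> 0 <= z <= k%:Z + 1 /\ z != x /\ z != y) ->
    exists x y : int, A = int_interval 0 (k%:Z + 1) `\` [fset x; y] /\
    [fset x; y] \in
      [:: [fset 1; 2]; [fset k%:Z - 1; k%:Z]; [fset 1; k%:Z]; [fset 2; k%:Z + 1];
          [fset 3; k%:Z + 1]; [fset k%:Z - 2; k%:Z + 1]; [fset k%:Z - 3; k%:Z + 1]].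
  by move=> xy H; exists x, y; split=> //; apply: AE.
clear - cE dE cost exact_cost mem_s kn listed.
(* Now [c + d = 2]. Either both ends have excess 1, or one has excess 2, in one of three ways, and
   the other has none: seven cases, one for each listed pair. The pairs containing [k + 1] are those
   where the maximum is [k]. *)
case: cE => [[E1 E2 E3 C]|[E1 E2 E3 C]|[E1 E2 E3 C]|[[E1 E2 E3 C]|[E1 E2 E3 C]]];
case: dE => [[F1 F2 F3 D]|[F1 F2 F3 D]|[F1 F2 F3 D]|[[F1 F2 F3 D]|[F1 F2 F3 D]]];
  try (exfalso; lia); rewrite {}E1 {}E2 {}E3 {}F1 {}F2 {}F3 in mem_s.
- apply: (listed (k%:Z - 1) k%:Z); first by rewrite !in_cons eqxx ?orbT.
  by move=> z; rewrite mem_s; lia.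
- apply: (listed (k%:Z - 2) (k%:Z + 1)); first by rewrite !in_cons eqxx ?orbT.
  by move=> z; rewrite mem_s; lia.
- apply: (listed (k%:Z - 3) (k%:Z + 1)); first by rewrite !in_cons eqxx ?orbT.
  by move=> z; rewrite mem_s; lia.
- apply: (listed 1 k%:Z); first by rewrite !in_cons eqxx ?orbT.
  by move=> z; rewrite mem_s; lia.
- apply: (listed 1 2); first by rewrite !in_cons eqxx ?orbT.
  by move=> z; rewrite mem_s; lia.
- apply: (listed 2 (k%:Z + 1)); first by rewrite !in_cons eqxx ?orbT.
  by move=> z; rewrite mem_s; lia.
- apply: (listed 3 (k%:Z + 1)); first by rewrite !in_cons eqxx ?orbT.
  by move=> z; rewrite mem_s; lia.
Qed.
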